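(* Let $L$ be a lattice. (1) If $L$ can be obtained through finite direct products and/or finite ordinal sums from chains and/or bounded distributive lattices, then $\mathrm{Spec}(L)=\mathrm{Max}(L)=\mathrm{Con}_2(L)$. (2) If $L$ can be obtained through finite direct products and/or finite ordinal sums from chains and/or bounded distributive lattices and/or finite modular lattices and/or relatively complemented lattices fulfilling the ascending chain condition, then $\mathrm{Spec}(L)=\mathrm{Max}(L)$. (3) If $L$ can be obtained through finite direct products and/or finite ordinal sums from chains and/or bounded distributive lattices and/or the pentagon, then $\mathrm{Max}(L)=\mathrm{Con}_2(L)$.
   Context: Lattices are non-empty. $\mathrm{Con}(L)$ is the lattice of congruences of $L$ ordered by inclusion, with greatest element $\nabla_L=L^2$. $\mathrm{Con}_2(L)=\{\theta\in \mathrm{Con}(L) : |L/\theta|=2\}$; $\mathrm{Max}(L)$ is the set of maximal elements of $\mathrm{Con}(L)\setminus\{\nabla_L\}$. Since the commutator of congruences of a lattice is the intersection, a congruence $\phi\neq\nabla_L$ is prime iff, for all $\alpha,\beta\in \mathrm{Con}(L)$, $\alpha\cap\beta\subseteq\phi$ implies $\alpha\subseteq\phi$ or $\beta\subseteq\phi$; $\mathrm{Spec}(L)$ is the set of prime congruences of $L$. For lattices $K$ with a greatest element and $M$ with a least element, the ordinal sum $K\oplus M$ is obtained by putting $M$ above $K$ and identifying the greatest element of $K$ with the least element of $M$. ''Obtained through finite direct products and/or finite ordinal sums from'' a collection of lattices means: belonging to the smallest class of lattices containing that collection and closed under finite direct products and under (defined) ordinal sums. The pentagon is the five-element non-modular lattice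 $\{0,x,y,z,1\}$ with $0<y<z<1$, $0<x<1$ and $x$ incomparable to $y$ and $z$. *)

(* Defs.v *)
From HB Require Import structures.
From mathcomp Require Import all_boot all_order.
From mathcomp Require Import boolp classical_sets functions cardinality.

Set Implicit Arguments.
Unset Strict Implicit.
Unset Printing Implicit Defensive.

Import Order.LTheory.
Local Open Scope classical_set_scope.
Local Open Scope order_scope.

Section Congruences.
Context {d : Order.disp_t} (L : latticeType d).
Implicit Types th phi alpha beta : set (L * L).

Record is_congruence th : Prop := IsCongruence {
  congr_refl : forall x, th (x, x);
  congr_sym : forall x y, th (x, y) -> th (y, x);
  congr_trans : forall x y z, th (x, y) -> th (y, z) -> th (x, z);
  congr_meet : forall x x' y y', th (x, x') -> th (y, y') ->
    th (Order.meet x y, Order.meet x' y');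
  congr_join : forall x x' y y', th (x, x') -> th (y, y') ->
    th (Order.join x y, Order.join x' y')
}.

Definition Con : set (set (L * L)) := [set th | is_congruence th].

Definition nabla : set (L * L) := setT.

Definition congr_class th (x : L) : set L := [set y | th (x, y)].

Definition quotient_set th : set (set L) := range (congr_class th).

Definition Con2 : set (set (L * L)) :=
  [set th | Con th /\ (quotient_set th #= `I_2)%card].

Definition MaxCon : set (set (L * L)) :=
  [set th | [/\ Con th, th <> nabla
    & forall phi, Con phi -> phi <> nabla -> th `<=` phi -> phi = th]].

(* The commutator of two lattice congruences is their intersection. *)
Definition SpecCon : set (set (L * L)) :=
  [set phi | [/\ Con phi, phi <> nabla
    & forall alpha beta, Con alpha -> Con beta ->
        (alpha `&` beta)%classic `<=` phi -> alpha `<=` phi \/ beta `<=` phi]].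

End Congruences.

Arguments Con {d} L _.
Arguments nabla {d} L _.
Arguments Con2 {d} L _.
Arguments MaxCon {d} L _.
Arguments SpecCon {d} L _.

Section DirectProduct.
Context {n : nat} {d : 'I_n -> Order.disp_t} (K : forall i, latticeType (d i)).

Definition dprod : Type := {dffun forall i : 'I_n, K i}.

HB.instance Definition _ := Choice.on dprod.

Implicit Types f g h : dprod.

Definition dprod_le f g := [forall i, f i <= g i].
Definition dprod_meet f g : dprod := [ffun i => Order.meet (f i) (g i)].
Definition dprod_join f g : dprod := [ffun i => Order.join (f i) (g i)].

Lemma dprod_le_refl : reflexive dprod_le.
Proof. by move=> f; apply/forallP => i. Qed.

Lemma dprod_le_anti : antisymmetric dprod_le.
Proof.
move=> f g /andP[/forallP fg /forallP gf]; apply/ffunP => i.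
by apply: le_anti; rewrite fg gf.
Qed.

Lemma dprod_le_trans : transitive dprod_le.
Proof.
move=> g f h /forallP fg /forallP gh; apply/forallP => i.
exact: le_trans (fg i) (gh i).
Qed.

HB.instance Definition _ := Order.Le_isPOrder.Build (Order.Disp tt tt) dprod
  dprod_le_refl dprod_le_anti dprod_le_trans.

Lemma dprod_lexI f g h : (f <= dprod_meet g h) = (f <= g) && (f <= h).
Proof.
apply/forallP/andP => [fgh | [/forallP fg /forallP fh] i].
  by split; apply/forallP => i; have := fgh i; rewrite ffunE lexI => /andP[].
by rewrite ffunE lexI fg fh.
Qed.

Lemma dprod_leUx f g h : (dprod_join f g <= h) = (f <= h) && (g <= h).
Proof.
apply/forallP/andP => [fgh | [/forallP fh /forallP gh] i].
  by split; apply/forallP => i; have := fgh i; rewrite ffunE leUx => /andP[].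
by rewrite ffunE leUx fh gh.
Qed.

HB.instance Definition _ :=
  Order.POrder_MeetJoin_isLattice.Build _ dprod dprod_lexI dprod_leUx.

End DirectProduct.

(* The least element of [M] is dropped, and its role is played by the greatest
   element of [K]. *)
Section OrdinalSum.
Context {dK dM : Order.disp_t} (K : tLatticeType dK) (M : bLatticeType dM).

Definition ordsum : Type := (K + {y : M | y != \bot})%type.

HB.instance Definition _ := Choice.on ordsum.

Implicit Types u v w : ordsum.

Definition ordsum_lower (x : K) : ordsum := inl x.

Definition ordsum_upper (y : M) : ordsum :=
  if insub y is Some y' then inr y' else inl \top.

Definition ordsum_le u v :=
  match u, v with
  | inl x, inl x' => x <= x'
  | inl _, inr _ => true
  | inr _, inl _ => false
  | inr y, inr y' => val y <= val y'
  end.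

Definition ordsum_meet u v :=
  match u, v with
  | inl x, inl x' => ordsum_lower (Order.meet x x')
  | inl x, inr _ => ordsum_lower x
  | inr _, inl x => ordsum_lower x
  | inr y, inr y' => ordsum_upper (Order.meet (val y) (val y'))
  end.

Definition ordsum_join u v :=
  match u, v with
  | inl x, inl x' => ordsum_lower (Order.join x x')
  | inl _, inr y => inr y
  | inr y, inl _ => inr y
  | inr y, inr y' => ordsum_upper (Order.join (val y) (val y'))
  end.

Lemma ordsum_le_refl : reflexive ordsum_le.
Proof. by case=> x /=. Qed.

Lemma ordsum_le_anti : antisymmetric ordsum_le.
Proof.
by case=> [x|y] [x'|y'] //= /le_anti; [move=> -> | move=> /val_inj ->].
Qed.

Lemma ordsum_le_trans : transitive ordsum_le.
Proof. by case=> [x|y] [x'|y'] [x''|y''] //=; apply: le_trans. Qed.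

HB.instance Definition _ := Order.Le_isPOrder.Build (Order.Disp tt tt) ordsum
  ordsum_le_refl ordsum_le_anti ordsum_le_trans.

Lemma ordsum_lexI u v w : (u <= ordsum_meet v w) = (u <= v) && (u <= w).
Proof.
case: v w => [v|v] [w|w] /=; case: u => [u|u];
  rewrite /Order.le /= ?andbT ?andbF ?lexI //.
  by rewrite /ordsum_upper; case: insubP => [z _ _ | _] //=; rewrite lex1.
rewrite /ordsum_upper -lexI; case: insubP => [z _ -> | /negPn/eqP vw0] //=.
by rewrite vw0 lex0 (negPf (valP u)).
Qed.

Lemma ordsum_leUx u v w : (ordsum_join u v <= w) = (u <= w) && (v <= w).
Proof.
have ub (y y' : M) : y != \bot -> Order.join y y' != \bot.
  by apply: contra => /eqP yy'0; rewrite -lex0 -yy'0 leUl.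
case: u v => [u|u] [v|v] /=; case: w => [w|w];
  rewrite /Order.le /= ?andbT ?andbF ?leUx //.
- by rewrite /ordsum_upper insubT ?ub ?(valP u).
- by rewrite /ordsum_upper insubT ?ub ?(valP u) // => h; rewrite /= leUx.
Qed.

HB.instance Definition _ :=
  Order.POrder_MeetJoin_isLattice.Build _ ordsum ordsum_lexI ordsum_leUx.

Lemma ordsum_lower_le (x x' : K) :
  (ordsum_lower x <= ordsum_lower x') = (x <= x').
Proof. by []. Qed.

Lemma ordsum_upper_le (y y' : M) :
  (ordsum_upper y <= ordsum_upper y') = (y <= y').
Proof.
rewrite /ordsum_upper.
case: insubP => [z z0 <- | /negPn/eqP ->];
  case: insubP => [z' _ <- | /negPn/eqP ->] //.
- by rewrite lex0 (negPf (valP z)).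
- by rewrite le0x.
- by rewrite [LHS]lexx lexx.
Qed.

Lemma ordsum_glue : ordsum_lower \top = ordsum_upper \bot.
Proof. by rewrite /ordsum_upper insubF // eqxx. Qed.

Lemma ordsum_cover u :
  (exists x, u = ordsum_lower x) \/ (exists y, u = ordsum_upper y).
Proof.
case: u => [x | y]; [by left; exists x | right; exists (val y)].
by rewrite /ordsum_upper valK.
Qed.

End OrdinalSum.

Definition lattice_class := forall d : Order.disp_t, latticeType d -> Prop.

Definition isomorphic {d d'} (K : latticeType d) (M : latticeType d') : Prop :=
  exists f : {lmorphism K -> M}, bijective f.

(* MathComp lattices may be empty, hence the nonemptiness condition in
   [obtained_base]; it is inherited by every obtained lattice. *)
Inductive obtained_from (B : lattice_class) : lattice_class :=
| obtained_base d (K : latticeType d) :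
    inhabited K -> B d K -> obtained_from B K
| obtained_prod n (d : 'I_n -> Order.disp_t) (K : forall i, latticeType (d i)) :
    (forall i, obtained_from B (K i)) -> obtained_from B (dprod K)
| obtained_sum dK dM (K : tLatticeType dK) (M : bLatticeType dM) :
    obtained_from B K -> obtained_from B M -> obtained_from B (ordsum K M)
| obtained_iso dK dM (K : latticeType dK) (M : latticeType dM) :
    isomorphic K M -> obtained_from B K -> obtained_from B M.

Section Properties.
Context {d : Order.disp_t} (L : latticeType d).

Definition is_chain : Prop := total (<=%O : rel L).

Definition is_bounded : Prop :=
  (exists b : L, forall x, b <= x) /\ (exists t : L, forall x, x <= t).

Definition is_distributive : Prop :=
  left_distributive (@Order.meet d L) (@Order.join d L).

Definition is_modular : Prop := forall x y z : L, x <= z ->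
  Order.join x (Order.meet y z) = Order.meet (Order.join x y) z.

Definition is_finite : Prop := finite_set [set: L].

Definition is_relatively_complemented : Prop :=
  forall a b x : L, a <= x -> x <= b ->
    exists y, [/\ a <= y, y <= b, Order.meet x y = a & Order.join x y = b].

Definition ascending_chain_condition : Prop :=
  ~ exists u : nat -> L, forall n, u n < u n.+1.

Definition is_pentagon : Prop :=
  exists zero x y z one : L,
    [/\ forall u : L, u \in [:: zero; x; y; z; one],
        [/\ zero < y, y < z & z < one],
        zero < x, x < one
      & x >< y /\ x >< z].

End Properties.

(* Main.v *)
(* Direct products and ordinal sums are finite subdirect products: K (+) M maps
   onto K by u |-> u /\ 1_K and onto M by u |-> u \/ 0_M, and these two maps
   separate points. A prime congruence contains the kernel of one of the
   projections, hence is pulled back from a prime congruence of one factor, so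
   Spec <= Con2, Spec <= Max and Max <= Con2 pass to finite subdirect products
   (for the last one, Max <= Spec by distributivity of Con(L)). In modular and
   in relatively complemented lattices the pairs whose interval contains no
   non-trivial psi-pair form a congruence, the pseudocomplement of psi, and
   under the chain conditions it generates everything together with psi. *)
Require Import Defs.
From mathcomp Require Import all_boot all_order.
From mathcomp Require Import boolp classical_sets functions cardinality.
From Stdlib Require Import Relations.

Set Implicit Arguments.
Unset Strict Implicit.
Unset Printing Implicit Defensive.

Import Order.LTheory.
Local Open Scope classical_set_scope.
Local Open Scope order_scope.

(** * Congruences of a single lattice: intervals, two classes, joins, maximality *)

Section Congruences.
Context {d : Order.disp_t} {L : latticeType d}.
Implicit Types (th phi psi alpha beta : set (L * L)) (a b c u v w x y z : L).

Lemma congruence_of_translations th :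
  (forall x, th (x, x)) -> (forall x y, th (x, y) -> th (y, x)) ->
  (forall x y z, th (x, y) -> th (y, z) -> th (x, z)) ->
  (forall z x y, th (x, y) -> th (x `&` z, y `&` z)) ->
  (forall z x y, th (x, y) -> th (x `|` z, y `|` z)) -> Con L th.
Proof.
move=> thxx thC thT thI thU; split=> // x x' y y' xx' yy'.
  by apply: thT (thI y _ _ xx') _; rewrite ![x' `&` _]meetC; apply: thI.
by apply: thT (thU y _ _ xx') _; rewrite ![x' `|` _]joinC; apply: thU.
Qed.

Lemma congr_meetr th z x y : Con L th -> th (x, y) -> th (x `&` z, y `&` z).
Proof. by move=> cth xy; apply: congr_meet => //; apply: congr_refl. Qed.

Lemma congr_joinr th z x y : Con L th -> th (x, y) -> th (x `|` z, y `|` z).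
Proof. by move=> cth xy; apply: congr_join => //; apply: congr_refl. Qed.

Lemma congr_meet_join th x y : Con L th -> th (x, y) -> th (x `&` y, x `|` y).
Proof.
move=> cth xy; apply: (congr_trans cth (y := y)).
  by have := congr_meetr y cth xy; rewrite meetxx.
by apply: (congr_sym cth); have := congr_joinr y cth xy; rewrite joinxx.
Qed.

(** The polynomial map [w |-> (w /\ v) \/ u] sends [a] to [u] and [c] to [v]. *)
Lemma congr_convex th a c u v : Con L th ->
  a <= u -> u <= v -> v <= c -> th (a, c) -> th (u, v).
Proof.
move=> cth au uv vc ac.
have := congr_joinr u cth (congr_meetr v cth ac).
by rewrite (meet_l (le_trans au uv)) (join_r au) (meet_r vc) (join_l uv).
Qed.

Lemma congr_interval th x y : Con L th -> th (x `&` y, x `|` y) -> th (x, y).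
Proof.
move=> cth h; apply: (congr_trans cth (y := x `&` y)).
  by apply: (congr_sym cth); apply: congr_convex h; rewrite ?leIl ?leUl.
by apply: congr_convex h; rewrite ?leIr ?leUr.
Qed.

Lemma nablaP th : (forall x y, th (x, y)) <-> th = nabla L.
Proof.
by split=> [h|-> //]; apply/seteqP; split=> // -[x y] _; apply: h.
Qed.

Lemma not_nablaP th : th <> nabla L <-> exists x y, ~ th (x, y).
Proof.
rewrite -nablaP; split=> [|[x [y nxy]] /(_ x y)//].
by move=> /existsNP[x /existsNP[y nxy]]; exists x, y.
Qed.

(** Trades cardinality of the quotient for two representatives: removing the classes of [a] and [b]
    from the quotient must leave nothing. *)
Lemma Con2P th : Con2 L th <->
  Con L th /\ exists a b, ~ th (a, b) /\ forall x, th (a, x) \/ th (b, x).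
Proof.
split=> -[cth].
  move/eq_cardSP=> [_ [a _ <-] /eq_cardSP[_ [[b _ <-] nba]]].
  rewrite II0 card_eq0 => /eqP rest0; split=> //; exists a, b.
  have clsE x y : th (x, y) -> congr_class th x = congr_class th y.
    move=> xy; apply/seteqP; split=> z /= h; apply: (congr_trans cth) h => //.
    exact: congr_sym cth _ _ xy.
  split=> [ab|x]; first by apply: nba; rewrite (clsE _ _ ab).
  have xx : congr_class th x x by apply: congr_refl cth _.
  have [xa|xa] := EM (congr_class th x = congr_class th a).
    by left; rewrite xa in xx.
  have [xb|xb] := EM (congr_class th x = congr_class th b).
    by right; rewrite xb in xx.
  have : ((quotient_set th `\ congr_class th a) `\ congr_class th b)%classic
           (congr_class th x) by split=> //; split=> //; exists x.
  by rewrite rest0.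
move=> [a [b [nab cov]]]; split=> //.
have nba : congr_class th b <> congr_class th a.
  by move=> ba; apply: nab; have : congr_class th b b by [apply: congr_refl];
    rewrite ba.
apply/eq_cardSP; exists (congr_class th a); first by exists a.
apply/eq_cardSP; exists (congr_class th b); first by split=> //; exists b.
rewrite II0 card_eq0; apply/eqP/seteqP; split=> // _ [[[x _ <-] xa] xb].
have clsE y z : th (y, z) -> congr_class th z = congr_class th y.
  move=> yz; apply/seteqP; split=> t /= h; apply: (congr_trans cth) h => //.
  exact: congr_sym cth _ _ yz.
by case: (cov x) => h; [apply: xa | apply: xb]; apply: clsE h.
Qed.

(** A proper [phi] above [th] still separates [a] from [b], since identifying them would merge both
    classes into one. So a [phi]-pair cannot straddle the two classes, and [phi] adds nothing to
    [th]. *)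
Lemma Con2_sub_Max : Con2 L `<=` MaxCon L.
Proof.
move=> th /Con2P[cth [a [b [nab cov]]]]; split=> //.
  by apply/not_nablaP; exists a, b.
move=> phi cphi /not_nablaP[x [y nxy]] thphi.
have nphi : ~ phi (a, b).
  move=> ab; apply: nxy.
  have all_a z : phi (a, z).
    by case: (cov z) => /thphi //; apply: (congr_trans cphi).
  exact: congr_trans cphi _ _ _ (congr_sym cphi (all_a x)) (all_a y).
apply/seteqP; split=> // -[u v] uv.
have aux p q : phi (p, u) -> phi (q, v) -> ~ phi (p, q) -> False.
  move=> pu qv; apply; apply: (congr_trans cphi pu).
  exact: congr_trans cphi _ _ _ uv (congr_sym cphi qv).
have nphi' : ~ phi (b, a) by move/(congr_sym cphi).
case: (cov u) (cov v) => hu [] hv.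
- exact: congr_trans cth _ _ _ (congr_sym cth hu) hv.
- by have := aux _ _ (thphi _ hu) (thphi _ hv) nphi.
- by have := aux _ _ (thphi _ hu) (thphi _ hv) nphi'.
- exact: congr_trans cth _ _ _ (congr_sym cth hu) hv.
Qed.

(** The join in Con(L): the union is already reflexive and symmetric, so its transitive closure is
    an equivalence. *)
Definition join_congr th psi : set (L * L) :=
  [set p | clos_trans L (fun x y => th (x, y) \/ psi (x, y)) p.1 p.2].

Lemma join_congr_Con th psi :
  Con L th -> Con L psi -> Con L (join_congr th psi).
Proof.
move=> cth cpsi.
(* A map compatible with every congruence carries a chain of [th]- and [psi]-steps to such a chain,
   link by link. *)
have translate (g : L -> L) :
    (forall th', Con L th' -> forall x y, th' (x, y) -> th' (g x, g y)) ->
    forall x y, join_congr th psi (x, y) -> join_congr th psi (g x, g y).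
  move=> gth x y; rewrite /join_congr /=.
  elim=> [{}x {}y [] xy|u v w _ uv _ vw]; last exact: t_trans uv vw.
    by apply: t_step; left; apply: gth.
  by apply: t_step; right; apply: gth.
apply: congruence_of_translations.
- by move=> x; apply: t_step; left; apply: congr_refl cth _.
- move=> x y; rewrite /join_congr /=.
  elim=> [{}x {}y [] xy|u v w _ uv _ vw]; last exact: t_trans vw uv.
    by apply: t_step; left; apply: congr_sym cth _ _ _.
  by apply: t_step; right; apply: congr_sym cpsi _ _ _.
- by move=> x y z; apply: t_trans.
- by move=> z; apply: translate => th' cth' x y; apply: congr_meetr.
- by move=> z; apply: translate => th' cth' x y; apply: congr_joinr.
Qed.

(* If beta is not below phi, then phi \/ beta is everything by maximality. A
   (phi \/ beta)-chain between a and c, retracted into the interval [a, c] by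
   w |-> (w \/ a) /\ c, has its beta-steps in alpha as well when alpha
   identifies a and c; hence all its steps are in phi. *)
Lemma Max_sub_Spec : MaxCon L `<=` SpecCon L.
Proof.
move=> phi [cphi nphi maxphi]; split=> // alpha beta calpha cbeta ab.
have [bphi|nbphi] := EM (beta `<=` phi); first by right.
left.
have joinT : join_congr phi beta = nabla L.
  apply: contrapT => nT; apply: nbphi.
  rewrite -(maxphi _ (join_congr_Con cphi cbeta) nT).
    by move=> -[x y] xy; apply: t_step; right.
  by move=> -[x y] xy; apply: t_step; left.
have intv a c : a <= c -> alpha (a, c) -> phi (a, c).
  move=> ac alphaac.
  have : join_congr phi beta (a, c) by rewrite joinT.
  pose g w := (w `|` a) `&` c.
  suff : forall x y,
      clos_trans L (fun x y => phi (x, y) \/ beta (x, y)) x y -> phi (g x, g y).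
    by move=> h /h; rewrite /g joinxx (join_l ac) meetxx (meet_l ac) //.
  move=> x y; elim=> [{}x {}y xy|u v w _ uv _ vw]; last first.
    exact: congr_trans cphi _ _ _ uv vw.
  have translate th' : Con L th' -> th' (x, y) -> th' (g x, g y).
    by move=> cth' xy'; apply: congr_meetr => //; apply: congr_joinr.
  case: xy => [/(translate _ cphi)//|/(translate _ cbeta) xy].
  apply: ab; split=> //; apply: congr_interval => //.
  have ag w : a <= g w by rewrite lexI leUr.
  apply: congr_convex alphaac => //; first by rewrite lexI !ag.
    exact: le_trans (leIl _ _) (leUl _ _).
  by rewrite leUx !leIr.
move=> -[x y] xy; apply: congr_interval => //; apply: intv.
  exact: le_trans (leIl _ _) (leUl _ _).
exact: congr_meet_join.
Qed.

End Congruences.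

(** * Surjective homomorphisms and pullback of congruences *)

Record is_quotient_map {d d'} (L : latticeType d) (K : latticeType d')
    (f : L -> K) : Prop := IsQuotientMap {
  qmap_meet : forall x y, f (x `&` y) = f x `&` f y;
  qmap_join : forall x y, f (x `|` y) = f x `|` f y;
  qmap_surj : forall u, exists x, f x = u
}.

Section QuotientMap.
Context {d d' : Order.disp_t} {L : latticeType d} {K : latticeType d'}.
Context (f : L -> K) (fq : is_quotient_map f).
Implicit Types (th psi : set (K * K)) (phi : set (L * L)).

Definition pullback th : set (L * L) := [set p | th (f p.1, f p.2)].

Lemma pullback_Con th : Con K th -> Con L (pullback th).
Proof.
move=> cth; split; rewrite /pullback /=.
- by move=> x; apply: congr_refl cth _.
- by move=> x y; apply: congr_sym.
- by move=> x y z; apply: congr_trans.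
- by move=> *; rewrite !(qmap_meet fq); apply: congr_meet.
- by move=> *; rewrite !(qmap_join fq); apply: congr_join.
Qed.

Lemma pullback_sub th psi : pullback th `<=` pullback psi -> th `<=` psi.
Proof.
move=> sub [u v]; have [x <-] := qmap_surj fq u.
by have [y <-] := qmap_surj fq v; apply: (sub (x, y)).
Qed.

Lemma pullback_inj th psi : pullback th = pullback psi -> th = psi.
Proof. by move=> e; apply/seteqP; split; apply: pullback_sub; rewrite e. Qed.

(** Correspondence theorem: the witness is the image of [phi] under [f]; as [phi] contains the
    kernel, membership does not depend on the chosen preimages. *)
Lemma pullbackP phi : Con L phi -> (forall x y, f x = f y -> phi (x, y)) ->
  exists2 th, Con K th & phi = pullback th.
Proof.
move=> cphi kphi.
pose th : set (K * K) :=
  [set p | exists x y, [/\ f x = p.1, f y = p.2 & phi (x, y)]].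
have thE x y : th (f x, f y) <-> phi (x, y).
  split=> [[x' [y' /= [xx' yy' h]]]|]; last by exists x, y.
  apply: (congr_trans cphi (y := x')); first exact: kphi.
  by apply: (congr_trans cphi h); apply: kphi.
have phiE : phi = pullback th by apply/seteqP; split=> -[x y] /thE.
exists th => //; split.
- move=> u; have [x <-] := qmap_surj fq u; apply/thE; exact: congr_refl cphi _.
- move=> u v; have [x <-] := qmap_surj fq u; have [y <-] := qmap_surj fq v.
  by rewrite !thE; apply: congr_sym.
- move=> u v w; have [x <-] := qmap_surj fq u; have [y <-] := qmap_surj fq v.
  by have [z <-] := qmap_surj fq w; rewrite !thE; apply: congr_trans.
- move=> u u' v v'; have [x <-] := qmap_surj fq u.
  have [x' <-] := qmap_surj fq u'; have [y <-] := qmap_surj fq v.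
  have [y' <-] := qmap_surj fq v'; rewrite -!(qmap_meet fq) !thE.
  exact: congr_meet.
- move=> u u' v v'; have [x <-] := qmap_surj fq u.
  have [x' <-] := qmap_surj fq u'; have [y <-] := qmap_surj fq v.
  have [y' <-] := qmap_surj fq v'; rewrite -!(qmap_join fq) !thE.
  exact: congr_join.
Qed.

Lemma pullback_nabla th : pullback th = nabla L <-> th = nabla K.
Proof.
by split=> [|->//]; rewrite -[nabla L]/(pullback (nabla K)) => /pullback_inj.
Qed.

Lemma pullback_Spec th : Con K th -> SpecCon L (pullback th) -> SpecCon K th.
Proof.
move=> cth [_ nth prime]; split=> //; first by rewrite -pullback_nabla.
move=> alpha beta calpha cbeta ab.
have [] := prime _ _ (pullback_Con calpha) (pullback_Con cbeta).
- by move=> p; apply: ab.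
- by left; apply: pullback_sub.
- by right; apply: pullback_sub.
Qed.

(** Every congruence above [pullback th] contains the kernel of [f], so it is itself a pullback and
    can be compared with [th] inside Con(K). *)
Lemma pullback_Max th : Con K th -> MaxCon L (pullback th) <-> MaxCon K th.
Proof.
move=> cth; split=> -[_ nth maxth]; split=> //.
- by rewrite -pullback_nabla.
- move=> psi cpsi npsi thpsi; apply: pullback_inj; apply: maxth.
  + exact: pullback_Con.
  + by rewrite pullback_nabla.
  + by move=> p; apply: thpsi.
- exact: pullback_Con.
- by rewrite pullback_nabla.
- move=> phi cphi nphi thphi.
  have [x y fxy|psi cpsi phiE] := pullbackP cphi.
    by apply: thphi; rewrite /pullback /= fxy; apply: congr_refl.
  subst phi; rewrite (maxth psi) // -?pullback_nabla //.
  exact: pullback_sub.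
Qed.

Lemma pullback_Con2 th : Con2 K th -> Con2 L (pullback th).
Proof.
move=> /Con2P[cth [a [b [nab cov]]]]; apply/Con2P; split.
  exact: pullback_Con.
have [x fx] := qmap_surj fq a; have [y fy] := qmap_surj fq b.
by exists x, y; rewrite /pullback /= fx fy; split=> // z; apply: cov.
Qed.

End QuotientMap.

(** * Finite subdirect products and their prime congruences *)

Definition subdirect_closed (P : lattice_class) : Prop :=
  forall d (L : latticeType d) (I : finType) (dK : I -> Order.disp_t)
    (K : forall i, latticeType (dK i)) (f : forall i, L -> K i),
  (forall i, is_quotient_map (f i)) ->
  (forall x y, (forall i, f i x = f i y) -> x = y) ->
  (forall i, P _ (K i)) -> P _ L.

Section Subdirect.
Context {d : Order.disp_t} {L : latticeType d} {I : finType}.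
Context {dK : I -> Order.disp_t} {K : forall i, latticeType (dK i)}.
Context {f : forall i, L -> K i} (fq : forall i, is_quotient_map (f i)).
Context (f_sep : forall x y, (forall i, f i x = f i y) -> x = y).

Lemma ker_Con i : Con L [set p | f i p.1 = f i p.2].
Proof.
split=> //=; first by move=> x y z ->.
  by move=> x x' y y' xx' yy'; rewrite !(qmap_meet (fq i)) xx' yy'.
by move=> x x' y y' xx' yy'; rewrite !(qmap_join (fq i)) xx' yy'.
Qed.

(** The finitely many kernels intersect in equality, which lies below [phi]; primality, iterated
    over the factors, selects one of them. *)
Lemma Spec_contains_ker phi : SpecCon L phi ->
  exists i, forall x y, f i x = f i y -> phi (x, y).
Proof.
move=> [cphi nphi prime].
(* [alpha] accumulates the kernels already split off from the list. It starts as [nabla L], which a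
   proper [phi] cannot contain. *)
suff inter (s : seq I) (alpha : set (L * L)) : Con L alpha ->
    (forall x y, alpha (x, y) -> (forall i, i \in s -> f i x = f i y) ->
      phi (x, y)) ->
    alpha `<=` phi \/ exists i, forall x y, f i x = f i y -> phi (x, y).
  have [||phiT|//] := inter (enum I) (nabla L).
  - by split.
  - move=> x y _ fxy; rewrite (@f_sep x y); first exact: congr_refl.
    by move=> i; apply: fxy; rewrite mem_enum.
  - by case: nphi; apply/nablaP => x y; apply: phiT.
elim: s alpha => [|i s IHs] alpha calpha sub.
  by left=> -[x y] xy; apply: sub xy _.
have cint : Con L (alpha `&` [set p | f i p.1 = f i p.2])%classic.
  have := calpha; have := ker_Con i => -[k1 k2 k3 k4 k5] [a1 a2 a3 a4 a5].
  split=> /=; first by split; [apply: a1 | ].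
  - by move=> x y [/a2 ? ->].
  - by move=> x y z [xy ->] [yz ->]; split=> //; apply: a3 xy yz.
  - by move=> x x' y y' [? ?] [? ?]; split; [apply: a4 | apply: k4].
  - by move=> x x' y y' [? ?] [? ?]; split; [apply: a5 | apply: k5].
case: (IHs _ cint) => [x y [xy fxy] fs||]; last by right.
  by apply: sub xy _ => j; rewrite inE => /predU1P[->|/fs].
move/(prime _ _ calpha (ker_Con i)) => [|sub_i]; first by left.
by right; exists i => x y fxy; apply: (sub_i (x, y)).
Qed.

Lemma Spec_pullback phi : SpecCon L phi ->
  exists i th, SpecCon (K i) th /\ phi = pullback (f i) th.
Proof.
move=> sphi; have [i ker_i] := Spec_contains_ker sphi.
have [cphi _ _] := sphi; have [th cth phiE] := pullbackP (fq i) cphi ker_i.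
by exists i, th; split=> //; apply: (pullback_Spec (fq i) cth); rewrite -phiE.
Qed.

End Subdirect.

Lemma subdirect_Spec_Con2 :
  subdirect_closed (fun d L => SpecCon L `<=` Con2 L).
Proof.
move=> d L I dK K f fq f_sep sub phi.
move=> /(Spec_pullback fq f_sep)[i [th [sth ->]]].
by apply: (pullback_Con2 (fq i)); apply: sub.
Qed.

Lemma subdirect_Spec_Max :
  subdirect_closed (fun d L => SpecCon L `<=` MaxCon L).
Proof.
move=> d L I dK K f fq f_sep sub phi.
move=> /(Spec_pullback fq f_sep)[i [th [sth ->]]].
apply/(pullback_Max (fq i)); last exact: sub.
by case: sth.
Qed.

Lemma subdirect_Max_Con2 :
  subdirect_closed (fun d L => MaxCon L `<=` Con2 L).
Proof.
move=> d L I dK K f fq f_sep sub phi mphi.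
have [i [th [sth phiE]]] := Spec_pullback fq f_sep (Max_sub_Spec mphi).
rewrite phiE; apply: (pullback_Con2 (fq i)); apply: sub.
have [cth _ _] := sth.
by apply/(pullback_Max (fq i) cth); rewrite -phiE.
Qed.

(** * Direct products, ordinal sums and isomorphic copies as subdirect products *)

Lemma obtained_inhabited (B : lattice_class) d (L : latticeType d) :
  obtained_from B L -> inhabited L.
Proof.
elim=> {d L} [//|n d K _ inhK|dK dM K M _ [x] _ _|dK dM K M [f _] _ [x]].
- pose x i := projT1 (cid (let: inhabits x := inhK i in ex_intro xpredT x isT)).
  exact: (inhabits [ffun i => x i]).
- exact: (inhabits (ordsum_lower M x)).
- exact: (inhabits (f x)).
Qed.

Section OrdinalSumProjections.
Context {dK dM : Order.disp_t} (K : tLatticeType dK) (M : bLatticeType dM).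

Definition ordsum_to_lower (u : ordsum K M) : K :=
  if u is inl x then x else \top.

Definition ordsum_to_upper (u : ordsum K M) : M :=
  if u is inr y then val y else \bot.

Lemma ordsum_upperK : cancel (@ordsum_upper _ _ K M) ordsum_to_upper.
Proof.
by move=> y; rewrite /ordsum_upper; case: insubP => [z _ <-|/negPn/eqP ->].
Qed.

Lemma ordsum_to_lower_upper y : ordsum_to_lower (ordsum_upper K y) = \top.
Proof. by rewrite /ordsum_upper; case: insubP. Qed.

Lemma ordsum_to_lower_quotient : is_quotient_map ordsum_to_lower.
Proof.
split; last by move=> x; exists (ordsum_lower M x).
  case=> [x|x] [y|y] //=; rewrite ?meetx1 ?meet1x ?meetxx //.
  exact: ordsum_to_lower_upper.
case=> [x|x] [y|y] //=; rewrite ?joinx1 ?join1x ?joinxx //.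
exact: ordsum_to_lower_upper.
Qed.

Lemma ordsum_to_upper_quotient : is_quotient_map ordsum_to_upper.
Proof.
split; last by move=> y; exists (ordsum_upper K y); apply: ordsum_upperK.
  case=> [x|x] [y|y] //=; rewrite ?meetx0 ?meet0x ?meetxx //.
  exact: ordsum_upperK.
case=> [x|x] [y|y] //=; rewrite ?joinx0 ?join0x ?joinxx //.
exact: ordsum_upperK.
Qed.

(** If [u] and [v] come from different summands, the upper projection would equate [\bot] with an
    element of the upper part, from which [\bot] is excluded. *)
Lemma ordsum_projections_sep u v :
  ordsum_to_lower u = ordsum_to_lower v ->
  ordsum_to_upper u = ordsum_to_upper v -> u = v.
Proof.
case: u v => [x|x] [y|y] //=; first by move->.
- by move=> _ e; case/eqP: (valP y).
- by move=> _ e; case/eqP: (valP x).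
- by move=> _ /val_inj ->.
Qed.

End OrdinalSumProjections.

(** Each constructor is one finite subdirect representation: coordinates indexed by ['I_n], the two
    projections of an ordinal sum indexed by [bool], and the inverse isomorphism indexed by
    [unit]. *)
Lemma obtained_from_subdirect (B P : lattice_class) :
  subdirect_closed P -> (forall d (K : latticeType d), B d K -> P d K) ->
  forall d (L : latticeType d), obtained_from B L -> P d L.
Proof.
move=> Pclosed BP d L.
elim=> {d L} [d K _|n d K obK PK|dK dM K M _ PK _ PM
              |dK dM K M [f [g fK gK]] _ PK].
- exact: BP.
- apply: (Pclosed _ _ 'I_n d K (fun i (x : dprod K) => x i)) => // [i|].
    split=> [x y|x y|u]; rewrite ?ffunE //.
    (* Surjectivity of the projection to factor [i]: put [u] at [i] and arbitrary points elsewhere,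
       which exist because all factors are nonempty. *)
    pose x j := projT1 (cid (let: inhabits x := obtained_inhabited (obK j)
                             in ex_intro xpredT x isT)).
    by exists [ffun j => dfwith x u j]; rewrite ffunE dfwith_in.
  by move=> x y xy; apply/ffunP.
- pose dN (b : bool) := if b then dK else dM.
  pose N b : latticeType (dN b) :=
    match b return latticeType (dN b) with true => K | false => M end.
  pose f b : ordsum K M -> N b :=
    match b return ordsum K M -> N b with
    | true => @ordsum_to_lower _ _ K M
    | false => @ordsum_to_upper _ _ K M
    end.
  apply: (Pclosed _ _ bool dN N f); last by case.
    by case; [apply: ordsum_to_lower_quotient | apply: ordsum_to_upper_quotient].
  by move=> x y xy; apply: ordsum_projections_sep (xy true) (xy false).
- apply: (Pclosed _ _ unit (fun=> dK) (fun=> K) (fun=> g)) => // [_|x y /(_ tt)].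
    split=> [x y|x y|x]; last by exists (f x).
      by apply: (can_inj fK); rewrite omorphI /= !gK.
    by apply: (can_inj fK); rewrite omorphU /= !gK.
  exact: (can_inj gK).
Qed.

(** * Distributive lattices: prime congruences have two classes *)

Section Distributive.
Context {d : Order.disp_t} {L : latticeType d} (distr : is_distributive L).

Lemma distributive_meetUr (x y z : L) :
  z `&` (x `|` y) = (z `&` x) `|` (z `&` y).
Proof. by rewrite meetC distr ![_ `&` z]meetC. Qed.

Lemma distributive_joinIl (x y z : L) :
  (x `&` y) `|` z = (x `|` z) `&` (y `|` z).
Proof.
by rewrite distributive_meetUr joinIK distr -joinA meetUKC.
Qed.

(* For every b the congruences "equal mod phi after meet with b" and "equal mod
   phi after join with b" intersect in phi, so one of them is phi: the class of
   b is the top or the bottom of L / phi. *)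
Lemma distributive_Spec_Con2 : SpecCon L `<=` Con2 L.
Proof.
move=> phi [cphi nphi prime]; apply/Con2P; split=> //.
pose below (b : L) : set (L * L) := [set p | phi (p.1 `&` b, p.2 `&` b)].
pose above (b : L) : set (L * L) := [set p | phi (p.1 `|` b, p.2 `|` b)].
have cbelow b : Con L (below b).
  apply: congruence_of_translations; rewrite /below /=.
  - by move=> x; apply: congr_refl cphi _.
  - by move=> x y; apply: congr_sym.
  - by move=> x y z; apply: congr_trans.
  - by move=> z x y xy; rewrite ![_ `&` z `&` b]meetAC; apply: congr_meetr.
  - by move=> z x y xy; rewrite !distr; apply: congr_joinr.
have cabove b : Con L (above b).
  apply: congruence_of_translations; rewrite /above /=.
  - by move=> x; apply: congr_refl cphi _.
  - by move=> x y; apply: congr_sym.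
  - by move=> x y z; apply: congr_trans.
  - by move=> z x y xy; rewrite !distributive_joinIl; apply: congr_meetr.
  - by move=> z x y xy; rewrite ![_ `|` z `|` b]joinAC; apply: congr_joinr.
have top_or_bot b :
    (forall x, phi (b, b `|` x)) \/ (forall x, phi (b, b `&` x)).
  have [|sub|sub] := prime _ _ (cbelow b) (cabove b).
  - move=> [x y] [/= meet_b join_b].
    (* By absorption and distributivity, [u = (u \/ b) /\ u] is congruent to
       [(v \/ b) /\ u = (v /\ u) \/ (b /\ u)]. For the pairs [(x, y)] and [(y, x)] the results
       differ only in [b /\ x] against [b /\ y], which [meet_b] identifies. *)
    have step u v : phi (u `|` b, v `|` b) -> phi (u, (v `&` u) `|` (b `&` u)).
      by move=> uv; have := congr_meetr u cphi uv; rewrite meetC joinKI distr.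
    apply: (congr_trans cphi (step _ _ join_b)).
    apply: (congr_sym cphi); apply: (congr_trans cphi).
      exact: step (congr_sym cphi join_b).
    rewrite [x `&` y]meetC ![_ `|` (b `&` _)]joinC ![b `&` _]meetC.
    by apply: congr_joinr => //; apply: congr_sym.
  - by left=> x; apply: sub; rewrite /below /= meetxx [_ `&` b]meetC joinKI;
      apply: congr_refl.
  - by right=> x; apply: sub; rewrite /above /= joinxx [_ `|` b]joinC meetKU;
      apply: congr_refl.
have tops b c : (forall x, phi (b, b `|` x)) -> (forall x, phi (c, c `|` x)) ->
    phi (b, c).
  move=> /(_ c) bc /(_ b) cb; apply: congr_trans bc _ => //.
  by rewrite joinC; apply: congr_sym.
have bots b c : (forall x, phi (b, b `&` x)) -> (forall x, phi (c, c `&` x)) ->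
    phi (b, c).
  move=> /(_ c) bc /(_ b) cb; apply: congr_trans bc _ => //.
  by rewrite meetC; apply: congr_sym.
(* Of two incongruent elements one must be the top class and the other the bottom class; every [x]
   then falls into one of them. *)
have /not_nablaP[a [b nab]] := nphi; exists a, b; split=> // x.
case: (top_or_bot a) (top_or_bot b) (top_or_bot x) => ha [] hb [] hx.
- by left; apply: tops.
- by case: nab; apply: tops.
- by left; apply: tops.
- by right; apply: bots.
- by right; apply: tops.
- by left; apply: bots.
- by case: nab; apply: bots.
- by left; apply: bots.
Qed.

End Distributive.

Lemma chain_distributive {d} (L : latticeType d) :
  is_chain L -> is_distributive L.
Proof.
move=> tot x y z; wlog xy : x y / x <= y.
  by move=> h; have [/h//|/h] := orP (tot x y); rewrite joinC => ->; apply: joinC.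
by rewrite (join_r xy) (join_r (leI2 xy (lexx z))).
Qed.

(** * Pseudocomplements in Con(L) and chain conditions *)

Section FreeCongruence.
Context {d : Order.disp_t} {L : latticeType d}.
Implicit Types (psi phi : set (L * L)) (a b c u v w x y z : L).

Definition trivial_on psi a c : Prop :=
  forall u v, a <= u -> u <= v -> v <= c -> psi (u, v) -> u = v.

(* When it is a congruence, this is the pseudocomplement of psi in Con(L). *)
Definition pseudocompl psi : set (L * L) :=
  [set p | trivial_on psi (p.1 `&` p.2) (p.1 `|` p.2)].

Lemma trivial_on_sub psi a c a' c' :
  a <= a' -> c' <= c -> trivial_on psi a c -> trivial_on psi a' c'.
Proof.
move=> aa cc tr u v au uv vc; apply: tr => //; first exact: le_trans au.
exact: le_trans vc cc.
Qed.

Lemma pseudocompl_le psi a c :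
  a <= c -> pseudocompl psi (a, c) <-> trivial_on psi a c.
Proof. by move=> ac; rewrite /pseudocompl /= (meet_l ac) (join_r ac). Qed.

Lemma pseudocompl_Con psi :
  (forall a b c, a <= b -> b <= c ->
     trivial_on psi a b -> trivial_on psi b c -> trivial_on psi a c) ->
  (forall a c z, a <= c ->
     trivial_on psi a c -> trivial_on psi (a `&` z) (c `&` z)) ->
  (forall a c z, a <= c ->
     trivial_on psi a c -> trivial_on psi (a `|` z) (c `|` z)) ->
  Con L (pseudocompl psi).
Proof.
move=> tT tI tU.
have leIU x y : x `&` y <= x `|` y by apply: le_trans (leIl _ _) (leUl _ _).
apply: congruence_of_translations; rewrite /pseudocompl /=.
- by move=> x u v; rewrite meetxx joinxx => xu uv vx _; apply: le_anti;
    rewrite uv (le_trans vx xu).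
- by move=> x y; rewrite meetC joinC.
- move=> x y z xy yz.
  (* Enlarge to the interval from [x /\ y /\ z] to [x \/ y \/ z] and cut it at [x /\ y] and
     [x \/ y]. The outer pieces are translates of [[y /\ z, y]] and [[y, y \/ z]]; the middle one is
     given by [xy]. *)
  apply: (@trivial_on_sub _ ((y `&` z) `&` (x `&` y)) ((y `|` z) `|` (x `|` y))).
  + by rewrite lexI; apply/andP; split;
      [apply: le_trans (leIr _ _) (leIl _ _) | apply: le_trans (leIl _ _) (leIr _ _)].
  + by rewrite leUx; apply/andP; split;
      [apply: le_trans (leUl _ _) (leUr _ _) | apply: le_trans (leUr _ _) (leUl _ _)].
  apply: (tT _ (x `&` y)); first exact: leIr.
  + exact: le_trans (leIU x y) (leUr _ _).
  + have yIz : trivial_on psi (y `&` z) y.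
      by apply: trivial_on_sub yz => //; apply: leUl.
    have := tI _ _ (x `&` y) (leIl y z) yIz.
    by rewrite [y `&` (x `&` y)]meet_r // leIr.
  apply: (tT _ (x `|` y)) => //; first exact: leUr.
  have yUz : trivial_on psi y (y `|` z).
    by apply: trivial_on_sub yz => //; apply: leIl.
  have := tU _ _ (x `|` y) (leUl y z) yUz.
  by rewrite [y `|` (x `|` y)]join_r // leUr.
- move=> z x y xy; apply: trivial_on_sub (tI _ _ z (leIU x y) xy).
    by rewrite lexI leI2 ?leIl // leI2 ?leIr.
  by rewrite leUx !leI2 ?leUl ?leUr.
- move=> z x y xy; apply: trivial_on_sub (tU _ _ z (leIU x y) xy).
    by rewrite lexI !leU2 ?leIl ?leIr.
  by rewrite leUx !leU2 ?leUl ?leUr.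
Qed.

Lemma acc_maximal (S : set L) x : ascending_chain_condition L -> S x ->
  exists m, S m /\ forall y, S y -> ~ m < y.
Proof.
move=> acc Sx; apply: contrapT => nomax; apply: acc.
have next (p : {m | S m}) : {q : {m | S m} | sval p < sval q}.
  apply: cid; apply: contrapT => h; apply: nomax.
  exists (sval p); split=> [|y Sy py]; first exact: svalP.
  by apply: h; exists (exist _ y Sy).
have [u [_ uS]] := dependent_choice next (exist _ x Sx).
by exists (fun n => sval (u n)).
Qed.

(** A maximal element of the class of [x /\ y] below [x \/ y] must be [x \/ y] itself, since
    otherwise one more step would lead above it. *)
Lemma congruence_full_of_steps psi : ascending_chain_condition L -> Con L psi ->
  (forall a b, a < b -> exists g, [/\ a < g, g <= b & psi (a, g)]) ->
  psi = nabla L.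
Proof.
move=> acc cpsi step; apply/nablaP => x y; apply: congr_interval => //.
have leIU : x `&` y <= x `|` y by apply: le_trans (leIl _ _) (leUl _ _).
set a := x `&` y in leIU *; set b := x `|` y in leIU *.
have [|m [[mb am] mmax]] :=
  @acc_maximal [set m | m <= b /\ psi (a, m)] a acc.
  by split=> //; apply: congr_refl.
have := mb; rewrite le_eqVlt => /predU1P[<-//|/step[g [mg gb psig]]].
by case: (mmax g) => //; split=> //; apply: congr_trans psig.
Qed.

(* psi and its pseudocomplement meet in the identity, so if the prime phi lies
   strictly below psi then it contains the pseudocomplement. *)
Lemma Spec_sub_Max_of_pseudocompl : ascending_chain_condition L ->
  (forall psi, Con L psi -> Con L (pseudocompl psi)) ->
  (forall psi, Con L psi ->
    (forall a b, a < b -> trivial_on psi a b -> psi (a, b)) ->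
    forall a b, a < b -> exists g, [/\ a < g, g <= b & psi (a, g)]) ->
  SpecCon L `<=` MaxCon L.
Proof.
move=> acc cpc step phi [cphi nphi prime]; split=> // psi cpsi npsi phipsi.
apply/seteqP; split=> //; apply: contrapT => npsiphi.
have [|//|pcphi] := prime _ _ cpsi (cpc _ cpsi).
  move=> [x y] [/(congr_meet_join cpsi) psixy pcxy].
  apply: congr_interval => //.
  have leIU : x `&` y <= x `|` y by apply: le_trans (leIl _ _) (leUl _ _).
  by rewrite (pcxy _ _ (lexx _) leIU (lexx _) psixy); apply: congr_refl.
(* An interval without non-trivial [psi]-pairs has its endpoints related by the pseudocomplement,
   hence by [phi] and by [psi]; this is what [step] asks for. *)
apply: npsi; apply: congruence_full_of_steps => //; apply: step => // a b ab tr.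
by apply: phipsi; apply: pcphi; apply/pseudocompl_le => //; apply: ltW.
Qed.

End FreeCongruence.

(** Such a sequence would embed [nat] into [T]. The relation is left abstract to serve for both
    ascending and descending chains. *)
Lemma finite_no_chain (T : Type) (r : T -> T -> Prop) :
  (forall x, ~ r x x) -> (forall x y z, r x y -> r y z -> r x z) ->
  finite_set [set: T] -> ~ exists u : nat -> T, forall n, r (u n) (u n.+1).
Proof.
move=> rxx rT finT [u ur].
have mono m n : (m < n)%N -> r (u m) (u n).
  elim: n => // n IHn; rewrite ltnS leq_eqVlt => /predU1P[->//|/IHn mn].
  exact: rT mn (ur n).
apply: infinite_nat; rewrite -(preimage_setT u); apply: finite_preimage finT.
move=> m n _ _ umn; case: (ltngtP m n) => // /mono; rewrite umn => h.
  by case: (rxx _ h).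
by case: (rxx _ h).
Qed.

(** * Finite modular lattices *)

Section Modular.
Context {d : Order.disp_t} {L : latticeType d} (mod : is_modular L).
Implicit Types (psi : set (L * L)) (a b c u v x y z : L).

(** In a modular lattice, [u <= v] with equal meets and equal joins with [b] forces [u = v]; the two
    triviality hypotheses supply these equalities. *)
Lemma modular_trivial_trans psi a b c : Con L psi -> a <= b -> b <= c ->
  trivial_on psi a b -> trivial_on psi b c -> trivial_on psi a c.
Proof.
move=> cpsi ab bc tab tbc u v au uv vc psiuv.
have Ib : u `&` b = v `&` b.
  apply: tab; rewrite ?leIr //; first by rewrite lexI au.
    exact: leI2.
  exact: congr_meetr.
have Ub : u `|` b = v `|` b.
  apply: tbc; rewrite ?leUr //; first exact: leU2.
    by rewrite leUx vc.
  exact: congr_joinr.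
have := mod b uv; rewrite Ub [_ `&` v]meetC [X in _ = X]meetC joinKI -Ib.
by rewrite meetKU.
Qed.

(** Joining with [a] sends [[a /\ z, c /\ z]] into [[a, c]], and by modularity meeting with [c /\ z]
    undoes it, so a non-trivial pair would survive in [[a, c]]. *)
Lemma modular_trivial_meet psi a c z : Con L psi -> a <= c ->
  trivial_on psi a c -> trivial_on psi (a `&` z) (c `&` z).
Proof.
move=> cpsi ac tac u v azu uv vcz psiuv.
have recover w : a `&` z <= w -> w <= c `&` z -> (w `|` a) `&` (c `&` z) = w.
  move=> azw wcz; rewrite -mod // [a `&` _]meetA (meet_l ac).
  exact: join_l.
rewrite -[u]recover ?(le_trans uv) // -[v]recover ?(le_trans azu) //.
rewrite (tac (u `|` a) (v `|` a)) ?leUr ?leU2 //.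
  by rewrite leUx ac andbT (le_trans vcz) ?leIl.
exact: congr_joinr.
Qed.

Lemma modular_trivial_join psi a c z : Con L psi -> a <= c ->
  trivial_on psi a c -> trivial_on psi (a `|` z) (c `|` z).
Proof.
move=> cpsi ac tac u v azu uv vcz psiuv.
have recover w : a `|` z <= w -> w <= c `|` z -> (a `|` z) `|` (c `&` w) = w.
  move=> azw wcz; rewrite mod // [_ `|` c]joinC joinA (join_l ac).
  exact: meet_r.
rewrite -[u]recover ?(le_trans uv) // -[v]recover ?(le_trans azu) //.
rewrite (tac (c `&` u) (c `&` v)) ?leIl ?leI2 //.
  by rewrite lexI ac (le_trans _ azu) ?leUl.
by rewrite ![c `&` _]meetC; apply: congr_meetr.
Qed.

Lemma finite_modular_Spec_Max : is_finite L -> SpecCon L `<=` MaxCon L.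
Proof.
move=> fin.
have acc : ascending_chain_condition L.
  apply: (@finite_no_chain L (fun x y => x < y)) fin => [x|x y z].
    by rewrite ltxx.
  exact: lt_trans.
have dcc : @ascending_chain_condition _ L^d.
  apply: (@finite_no_chain L (fun x y => y < x)) fin => [x|x y z].
    by rewrite ltxx.
  by move=> xy yz; apply: lt_trans yz xy.
apply: Spec_sub_Max_of_pseudocompl => // [psi cpsi|psi cpsi step a b ab].
  apply: pseudocompl_Con.
  - by move=> u v w; apply: modular_trivial_trans.
  - by move=> u w z; apply: modular_trivial_meet.
  - by move=> u w z; apply: modular_trivial_join.
(* [g] is an atom of [[a, b]], found as a maximal element in the dual order. The interval [[a, g]]
   has only its endpoints, so if [(a, g)] were not in [psi] it would be trivial, and [step] would
   put it in [psi]. *)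
have [//|g [[ag gb] gmin]] :=
  @acc_maximal _ L^d [set g : L | a < g /\ g <= b] b dcc.
exists g; split=> //; have [//|ntr] := EM (psi (a, g)).
apply: step => // u v au uv vg psiuv.
have := uv; rewrite le_eqVlt => /predU1P[//|luv].
have below w : a < w -> w <= g -> w = g.
  move=> aw wg; have := wg; rewrite le_eqVlt => /predU1P[//|lwg].
  by case: (gmin w) => //; split=> //; apply: le_trans wg gb.
have vE : v = g by apply: below => //; apply: le_lt_trans luv.
move: au; rewrite le_eqVlt => /predU1P[au|au].
  by case: ntr; rewrite au -vE.
by rewrite vE; apply: below => //; rewrite -vE.
Qed.

End Modular.

(** * Relatively complemented lattices with the ascending chain condition *)

Section RelativelyComplemented.
Context {d : Order.disp_t} {L : latticeType d}.
Context (rc : is_relatively_complemented L).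
Implicit Types (psi : set (L * L)) (a b c u v e z : L).

(** Any [psi]-pair can be moved up to the top: for [e] a complement of [v] in [[u, c]], joining
    [(u, v)] with [e] yields [(e, c)]. *)
Lemma rc_trivial_top psi a c : Con L psi ->
  (forall e, a <= e -> e <= c -> psi (e, c) -> e = c) -> trivial_on psi a c.
Proof.
move=> cpsi top u v au uv vc psiuv.
have [e [ue ec ve vUe]] := rc uv vc.
have eE : e = c.
  apply: top => //; first exact: le_trans ue.
  by have := congr_joinr e cpsi psiuv; rewrite vUe (join_r ue).
by rewrite -ve eE; apply/meet_idPl.
Qed.

(** A pair [(e, c)] at the top is moved down to [(a, g)] by meeting with a complement [g] of [e] in
    [[a, c]]. *)
Lemma rc_trivial_bottom psi a c : Con L psi ->
  (forall e, a <= e -> e <= c -> psi (a, e) -> e = a) -> trivial_on psi a c.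
Proof.
move=> cpsi bot; apply: rc_trivial_top => // e ae ec psiec.
have [g [ag gc eg eUg]] := rc ae ec.
have gE : g = a.
  apply: bot => //.
  by have := congr_meetr g cpsi psiec; rewrite eg [c `&` g]meetC (meet_l gc).
by rewrite -eUg gE join_l.
Qed.

(** By the criterion at the top only pairs [(e, c)] matter: meeting with [b] gives a pair in
    [[a, b]], so [b <= e], and then [(e, c)] lies in [[b, c]]. *)
Lemma rc_trivial_trans psi a b c : Con L psi -> a <= b -> b <= c ->
  trivial_on psi a b -> trivial_on psi b c -> trivial_on psi a c.
Proof.
move=> cpsi ab bc tab tbc; apply: rc_trivial_top => // e ae ec psiec.
have eb : e `&` b = b.
  apply: tab; rewrite ?lexI ?ae ?leIr //.
  by have := congr_meetr b cpsi psiec; rewrite (meet_r bc).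
by apply: tbc => //; rewrite -eb leIl.
Qed.

Lemma rc_trivial_meet psi a c z : Con L psi -> a <= c ->
  trivial_on psi a c -> trivial_on psi (a `&` z) (c `&` z).
Proof.
move=> cpsi ac tac; apply: rc_trivial_bottom => // e aze ecz psie.
have ea : a = e `|` a.
  apply: tac; rewrite ?leUr //.
    by rewrite leUx ac andbT (le_trans ecz) ?leIl.
  by have := congr_joinr a cpsi psie; rewrite joinC meetKU.
apply: le_anti; rewrite aze andbT lexI (le_trans ecz (leIr _ _)) andbT.
by rewrite ea leUl.
Qed.

Lemma rc_trivial_join psi a c z : Con L psi -> a <= c ->
  trivial_on psi a c -> trivial_on psi (a `|` z) (c `|` z).
Proof.
move=> cpsi ac tac; apply: rc_trivial_top => // e aze ecz psie.
have ec : e `&` c = c.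
  apply: tac; rewrite ?leIr //.
    by rewrite lexI ac andbT (le_trans _ aze) ?leUl.
  by have := congr_meetr c cpsi psie; rewrite [(c `|` z) `&` c]meetC joinKI.
apply: le_anti; rewrite ecz /= leUx (le_trans (leUr _ _) aze) andbT.
by rewrite -ec leIl.
Qed.

Lemma rc_acc_Spec_Max :
  ascending_chain_condition L -> SpecCon L `<=` MaxCon L.
Proof.
move=> acc.
apply: Spec_sub_Max_of_pseudocompl => // [psi cpsi|psi cpsi step a b ab].
  apply: pseudocompl_Con.
  - by move=> u v w; apply: rc_trivial_trans.
  - by move=> u w z; apply: rc_trivial_meet.
  - by move=> u w z; apply: rc_trivial_join.
(* If no [psi]-step started at [a] inside [[a, b]], the criterion at the bottom would make the
   interval trivial; [step] would then make [(a, b)] such a step. *)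
apply: contrapT => nostep.
apply: (nostep); exists b; split=> //; apply: step => //.
apply: rc_trivial_bottom => // e ae eb psie.
apply: contrapT => nea; apply: nostep; exists e; split=> //.
by rewrite lt_neqAle ae andbT; apply/eqP => /esym.
Qed.

End RelativelyComplemented.

(** * The pentagon *)

Section Pentagon.
Context {d : Order.disp_t} {L : latticeType d}.

(* The up-set of a is a prime filter as soon as it is the complement of the
   down-set of b. *)
Lemma principal_filter_Con2 (a b : L) : ~~ (a <= b) ->
  (forall u, (a <= u) || (u <= b)) -> Con2 L [set p | (a <= p.1) = (a <= p.2)].
Proof.
move=> nab cov.
have leab u : (u <= b) = ~~ (a <= u).
  have := cov u; case: (boolP (a <= u)) => //= au _; apply/negP => ub.
  by case/negP: nab; apply: le_trans ub.
have leaU u v : (a <= u `|` v) = (a <= u) || (a <= v).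
  by apply: negb_inj; rewrite negb_or -!leab leUx.
apply/Con2P; split.
  split=> //=; first by move=> x y z ->.
    by move=> x x' y y' xx' yy'; rewrite !lexI xx' yy'.
  by move=> x x' y y' xx' yy'; rewrite !leaU xx' yy'.
exists a, b; split=> /=; first by rewrite lexx (negPf nab).
by move=> u; rewrite lexx (negPf nab); case: (a <= u); [left | right].
Qed.

(** The up-sets of [x] and [y] are the complements of the down-sets of [z] and [x], so each gives a
    congruence with two classes. A maximal [phi] below neither would collapse [o] with both [x] and
    [y], hence with [x \/ y = i]. *)
Lemma pentagon_Max_Con2 : is_pentagon L -> MaxCon L `<=` Con2 L.
Proof.
move=> [o [x [y [z [i [cov [oy yz zi] ox xi [xy xz]]]]]]] phi mphi.
have [cphi nphi maxphi] := mphi.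
have nxz : ~~ (x <= z) by apply: contra xz => h; rewrite /Order.comparable h.
have nyx : ~~ (y <= x).
  by apply: contra xy => h; rewrite /Order.comparable h orbT.
have covx u : (x <= u) || (u <= z).
  have := cov u; rewrite !inE => /orP[|/or4P[]] /eqP ->;
  by rewrite ?lexx ?orbT ?(ltW xi) ?(ltW yz) ?(ltW (lt_trans oy yz)) ?orbT.
have covy u : (y <= u) || (u <= x).
  have := cov u; rewrite !inE => /orP[|/or4P[]] /eqP ->;
  by rewrite ?lexx ?orbT ?(ltW ox) ?(ltW yz) ?(ltW (lt_trans yz zi)) ?orbT.
have ole u : o <= u.
  have := cov u; rewrite !inE => /orP[|/or4P[]] /eqP ->;
  by rewrite ?lexx ?(ltW ox) ?(ltW oy) ?(ltW (lt_trans oy yz)) ?(ltW (lt_trans ox xi)).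
have lei u : u <= i.
  have := cov u; rewrite !inE => /orP[|/or4P[]] /eqP ->;
  by rewrite ?lexx ?(ltW xi) ?(ltW zi) ?(ltW (lt_trans yz zi)) ?(ltW (lt_trans ox xi)).
have xIz : x `&` z = o.
  have lx : x `&` z <= x := leIl _ _; have lz : x `&` z <= z := leIr _ _.
  move: lx lz; have := cov (x `&` z); rewrite !inE => /orP[|/or4P[]] /eqP -> //.
  - by move=> _ xlez; rewrite xlez in nxz.
  - by move=> ylex; rewrite ylex in nyx.
  - by move=> /(le_trans (ltW yz)) ylex; rewrite ylex in nyx.
  - by move=> _ /(le_trans (ltW xi)) xlez; rewrite xlez in nxz.
have xUy : x `|` y = i.
  have gx : x <= x `|` y := leUl _ _; have gy : y <= x `|` y := leUr _ _.
  move: gx gy; have := cov (x `|` y); rewrite !inE => /orP[|/or4P[]] /eqP -> //.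
  - by move=> _ /le_trans/(_ (ltW ox)) ylex; rewrite ylex in nyx.
  - by move=> _ ylex; rewrite ylex in nyx.
  - by move=> /le_trans/(_ (ltW yz)) xlez; rewrite xlez in nxz.
  - by move=> xlez; rewrite xlez in nxz.
(* A [phi]-pair with [a <= p] and not [a <= q] has [q <= b]; meeting it with [a] turns it into
   [(a, o)]. *)
have collapse a b : (forall u, (a <= u) || (u <= b)) -> a `&` b = o ->
    ~ phi `<=` [set p | (a <= p.1) = (a <= p.2)] -> phi (o, a).
  move=> covab abo /existsNP[[p q] /not_implyP[pq /= apq]].
  wlog [ap naq] : p q pq {apq} / a <= p /\ ~~ (a <= q).
    move=> h; case: (boolP (a <= p)) (boolP (a <= q)) apq => [ap|nap] [aq|naq] //.
      by move=> _; apply: h pq _.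
    by move=> _; apply: (h q p); [apply: congr_sym|].
  have qb : q <= b by have := covab q; rewrite (negPf naq).
  have := congr_meetr a cphi (congr_sym cphi pq); rewrite [p `&` a]meetC (meet_l ap).
  have -> // : q `&` a = o.
  by apply: le_anti; rewrite ole andbT -abo meetC leI2.
have [sub|/(collapse _ _ covx xIz) xo] :=
  EM (phi `<=` [set p | (x <= p.1) = (x <= p.2)]).
  have cx := principal_filter_Con2 nxz covx; have [_ nx _] := Con2_sub_Max cx.
  by rewrite -(maxphi _ _ nx sub) //; case: cx.
have yIx : y `&` x = o.
  by apply: le_anti; rewrite ole andbT -xIz meetC leI2 // ltW.
have [sub|/(collapse _ _ covy yIx) yo] :=
  EM (phi `<=` [set p | (y <= p.1) = (y <= p.2)]).
  have cy := principal_filter_Con2 nyx covy; have [_ ny _] := Con2_sub_Max cy.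
  by rewrite -(maxphi _ _ ny sub) //; case: cy.
case: nphi; apply/nablaP => u v; apply: congr_interval => //.
have := congr_join cphi xo yo; rewrite xUy joinxx.
by apply: congr_convex; rewrite ?ole ?lei // (le_trans (leIl u v) (leUl u v)).
Qed.

End Pentagon.

(** * The three statements, assembled from the generating classes *)

Theorem proposition6p12 (d : Order.disp_t) (L : latticeType d)
    (L_nonempty : inhabited L) :
  (obtained_from (fun d' K =>
       is_chain K \/ (is_bounded K /\ is_distributive K)) L ->
     SpecCon L = MaxCon L /\ MaxCon L = Con2 L) /\
  (obtained_from (fun d' K =>
       is_chain K \/ (is_bounded K /\ is_distributive K) \/
       (is_finite K /\ is_modular K) \/
       (is_relatively_complemented K /\ ascending_chain_condition K)) L ->
     SpecCon L = MaxCon L) /\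
  (obtained_from (fun d' K =>
       is_chain K \/ (is_bounded K /\ is_distributive K) \/
       is_pentagon K) L ->
     MaxCon L = Con2 L).
Proof.
have chainP d' (K : latticeType d') : is_chain K -> SpecCon K `<=` Con2 K.
  by move=> /chain_distributive; apply: distributive_Spec_Con2.
split; [move=> obL | split=> obL].
(* [Con2 <= Max <= Spec] holds in every lattice, so this one inclusion gives both equalities. *)
- have sub : SpecCon L `<=` Con2 L.
    move: obL; apply: (obtained_from_subdirect subdirect_Spec_Con2) => d' K.
    by case=> [/chainP|[_ /distributive_Spec_Con2]].
  split; apply/seteqP; split.
  + by move=> th /sub /Con2_sub_Max.
  + exact: Max_sub_Spec.
  + by move=> th /Max_sub_Spec /sub.
  + exact: Con2_sub_Max.
- apply/seteqP; split; last exact: Max_sub_Spec.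
  move: obL; apply: (obtained_from_subdirect subdirect_Spec_Max) => d' K.
  case=> [/chainP sub|[[_ /distributive_Spec_Con2 sub]|[[fin mod]|[rc acc]]]].
  + by move=> th /sub /Con2_sub_Max.
  + by move=> th /sub /Con2_sub_Max.
  + exact: finite_modular_Spec_Max.
  + exact: rc_acc_Spec_Max.
- apply/seteqP; split; last exact: Con2_sub_Max.
  move: obL; apply: (obtained_from_subdirect subdirect_Max_Con2) => d' K.
  case=> [/chainP sub|[[_ /distributive_Spec_Con2 sub]|pent]].
  + by move=> th /Max_sub_Spec /sub.
  + by move=> th /Max_sub_Spec /sub.
  + exact: pentagon_Max_Con2.
Qed.
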